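(* Let $(p_n)_{n\ge1}$ be an arbitrary sequence of positive integers with $p_n\le n$; write $p=p_n$. For each $n$, let $Y_1,\ldots,Y_n$ be i.i.d. $p$-dimensional random (column) vectors whose coordinates are i.i.d. with probability density in $\mathcal{P}(1)$, this density remaining fixed as $n$ and $p$ vary. Let $$W:=\frac1n\sum_{i=1}^n(Y_i-\bar Y)(Y_i-\bar Y)^T,\qquad \bar Y:=\frac1n\sum_{i=1}^nY_i .$$ Then, as $n\to\infty$, $\log\det W$ has fluctuations of order at least $\sqrt{p/n}$.
   Context: Convention: $\log 0=-\infty$; $x^T$ denotes the transpose of a column vector $x$. Class $\mathcal{P}(1)$: the set of all probability densities of the form $e^{-V}$ on $\mathbb{R}$, where $V$ is a $C^\infty$ function, $V$ and all its derivatives have at most polynomial growth at infinity, and $e^{V}$ increases faster than any polynomial at infinity. Fluctuations: for a sequence of random variables $\{X_n\}$ (possibly taking the value $-\infty$) and a sequence of positive real numbers $\{\delta_n\}$, we say that $X_n$ has fluctuations of order at least $\delta_n$ if there are positive constants $c_1,c_2$ such that for all large $n$, and for all $-\infty<a\le b<\infty$ with $b-a\le c_1\delta_n$, $\mathbb{P}(a\le X_n\le b)\le 1-c_2$. *)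

(* Defs.v *)
From HB Require Import structures.
From mathcomp Require Import all_boot all_order all_algebra.
From mathcomp Require Import all_classical all_reals all_analysis.
Import Order.TTheory GRing.Theory Num.Theory.
Import numFieldNormedType.Exports.

Set Implicit Arguments.
Unset Strict Implicit.
Unset Printing Implicit Defensive.

Local Open Scope classical_set_scope.
Local Open Scope ring_scope.

(* [derive1n 0 f] is [f], so [k = 0] gives differentiability of [f] itself. *)
Definition smooth (R : realType) (f : R -> R) : Prop :=
  forall (k : nat) (x : R), derivable (derive1n k f) x 1.

Definition polynomial_growth (R : realType) (f : R -> R) : Prop :=
  exists (C M : R) (m : nat),
    forall x : R, M <= `|x| -> `|f x| <= C * `|x| ^+ m.

Definition superpolynomial_growth (R : realType) (f : R -> R) : Prop :=
  forall m : nat,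
    (f x / `|x| ^+ m @[x --> +oo] --> +oo) /\
    (f x / `|x| ^+ m @[x --> -oo] --> +oo).

Definition class_P1 (R : realType) (f : R -> R) : Prop :=
  exists V : R -> R,
    [/\ f = (fun x => expR (- V x)),
        (\int[lebesgue_measure]_(x in [set: R]) (f x)%:E = 1)%E,
        smooth V,
        forall k : nat, polynomial_growth (derive1n k V) &
        superpolynomial_growth (fun x => expR (V x))].

Definition mutually_independent (R : realType) (d d' : measure_display)
    (T : measurableType d) (U : measurableType d') (P : probability T R)
    (I : finType) (X : I -> T -> U) : Prop :=
  forall (J : {set I}) (A : I -> set U), (forall i, measurable (A i)) ->
    P (\bigcap_(i in [set` J]) X i @^-1` A i) =
    (\prod_(i in J) P (X i @^-1` A i))%E.

Definition identically_distributed (R : realType) (d d' : measure_display)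
    (T : measurableType d) (U : measurableType d') (P : probability T R)
    (I : finType) (X : I -> T -> U) : Prop :=
  forall (i j : I) (A : set U), measurable A ->
    P (X i @^-1` A) = P (X j @^-1` A).

Definition has_density (R : realType) (d : measure_display)
    (T : measurableType d) (P : probability T R) (X : T -> R)
    (f : R -> R) : Prop :=
  forall A : set R, measurable A ->
    P (X @^-1` A) = (\int[lebesgue_measure]_(x in A) (f x)%:E)%E.

(* Random vectors take values in [p.-tuple R], which carries the product
   sigma-algebra in the library. *)
Definition iid_vectors_iid_coordinates (R : realType) (d : measure_display)
    (T : measurableType d) (P : probability T R) (n p : nat)
    (Y : 'I_n -> {RV P >-> p.-tuple R}) (f : R -> R) : Prop :=
  [/\ mutually_independent P (fun i => Y i : T -> p.-tuple R),
      identically_distributed P (fun i => Y i : T -> p.-tuple R),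
      forall i : 'I_n,
        mutually_independent P (fun (j : 'I_p) (w : T) => tnth (Y i w) j) &
      forall (i : 'I_n) (j : 'I_p),
        has_density P (fun w : T => tnth (Y i w) j) f].

Definition col_of_tuple (R : realType) (p : nat) (t : p.-tuple R) : 'cV[R]_p :=
  \col_(j < p) tnth t j.

Definition sample_mean (R : realType) (n p : nat)
    (y : 'I_n -> 'cV[R]_p) : 'cV[R]_p :=
  n%:R^-1 *: \sum_(i < n) y i.

Definition sample_covariance (R : realType) (n p : nat)
    (y : 'I_n -> 'cV[R]_p) : 'M[R]_p :=
  n%:R^-1 *:
    \sum_(i < n) ((y i - sample_mean y) *m (y i - sample_mean y)^T).

Definition fluctuations_of_order_at_least (R : realType)
    (d : nat -> measure_display) (T : forall n, measurableType (d n))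
    (P : forall n, probability (T n) R) (X : forall n, T n -> \bar R)
    (delta : nat -> R) : Prop :=
  exists c1 c2 : R, [/\ 0 < c1, 0 < c2 &
    \forall n \near \oo, forall a b : R, a <= b -> b - a <= c1 * delta n ->
      (P n [set w | (a%:E <= X n w <= b%:E)%E] <= (1 - c2)%:E)%E].

(* Main.v *)
From HB Require Import structures.
Require Import Defs.
From mathcomp Require Import all_boot all_order all_algebra.
From mathcomp Require Import all_classical all_reals all_analysis.
From mathcomp Require Import measurable_realfun ring lra zify.
Import Order.TTheory GRing.Theory Num.Theory.
Import numFieldNormedType.Exports.

Set Implicit Arguments.
Unset Strict Implicit.
Unset Printing Implicit Defensive.

Local Open Scope classical_set_scope.
Local Open Scope ring_scope.

(** The idea is to compare the data with a slightly dilated copy of itself.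
Multiplying every coordinate of every vector by [e^s] multiplies the
covariance matrix by [e^(2s)], hence shifts its log-determinant by exactly
[2ps].  Take [s = c / sqrt (np)], so that the shift is [2c sqrt (p/n)], more
than the length of an interval [[a, b]] with [b - a <= c sqrt (p/n)].  The
original and the dilated data then cannot both have their log-determinant in
[[a, b]], so the corresponding set [B] of data matrices satisfies
[mu B + mu' B <= 1], where [mu] and [mu'] are the two laws.  If [mu] and [mu']
overlap enough, this forces [mu B] away from [1].

The overlap is measured by the Hellinger affinity [E (sqrt (dmu'/dmu))].  If
it is at least [h], an inequality of arithmetic and geometric means gives
[mu B <= 1 - h^2/4] ([two_point_bound]).  The affinity is multiplicative over
the [np] independent coordinates ([integral_prod_independent]), so by
Bernoulli's inequality it suffices that one coordinate has affinity at least
[1 - C s^2] ([hellinger_affinity_scale]): then the total affinity is at least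
[1 - np C s^2 = 1 - C c^2], which is at least [1/2] when [c] is small.

For one coordinate, with density [f = e^(-V)], the affinity is
[1 - 1/2 int (r s - r 0)^2] where [r t] is the square root of the dilated
density [e^(-t) f (e^(-t) x)].  The mean value theorem bounds
[(r s - r 0)^2] by [s^2] times the supremum of [(r')^2], and [(r')^2] is a
quarter of the dilation of [(1 - y V' y)^2 e^(-V y)].  Polynomial growth
of [V'] and superpolynomial growth of [e^V] bound this by a multiple of
[1 / (1 + y^2)] ([score_decay]), which is integrable.

The density of [mu'] with respect to [mu] is obtained in
[change_of_product_law] from uniqueness of measures on the pi-system of
rectangles.  The argument sees the determinant only as a measurable
homogeneous function of the data, and is carried out in that generality in
[prob_homogeneous_statistic_le]. *)

(** * Transporting integrals of nonnegative functions *)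

Section integrals.
Local Open Scope ereal_scope.
Import HBNNSimple.

(** Since [0 * +oo = 0], multiplication by [+oo] is not continuous at [0];
monotonicity saves the limit, a nondecreasing nonnegative sequence that tends
to [0] being constant. *)
Lemma ge0_nondecreasing_cvgeMr (R : realType) (g : nat -> R) (l y : \bar R) :
  (forall n, (0 <= g n)%R) -> nondecreasing_seq g ->
  (g n)%:E @[n --> \oo] --> l -> 0 <= y ->
  (g n)%:E * y @[n --> \oo] --> l * y.
Proof.
move=> g0 ndg gl; case: y => [y|_|//] y0; first exact: cvgeZr.
have [l0|l0] := leP l 0.
  have gE n : g n = 0%R.
    apply/le_anti; rewrite g0 andbT -lee_fin (le_trans _ l0)//.
    have /ereal_nondecreasing_cvgn/(cvg_unique _ gl) -> // :
        nondecreasing_seq (fun n => (g n)%:E).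
      by move=> m k mk; rewrite lee_fin; exact: ndg.
    by apply: ereal_sup_ubound; exists n.
  have -> : l = 0.
    by rewrite -(cvg_lim _ gl)//; under eq_fun do rewrite gE; rewrite lim_cst.
  by under eq_fun do rewrite gE mul0e; rewrite mul0e; exact: cvg_cst.
rewrite gt0_muley//; apply: cvg_near_cst.
have : \forall n \near \oo, 0 < (g n)%:E.
  by apply: (gl (fun z => 0 < z)); exact: open_ereal_gt'.
by apply: filterS => n gn; rewrite gt0_muley.
Qed.

(** The right-hand side involves the data [mu], [Z], [w] only through the
weights that they give to preimages of sets; this is what makes
[ge0_eq_integral_of_sets] hold. *)
Lemma ge0_integral_weighted_approx (R : realType) (dX dU : measure_display)
    (X : measurableType dX) (U : measurableType dU)
    (mu : {measure set X -> \bar R}) (Z : X -> U) (w : X -> \bar R)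
    (h : U -> \bar R) (mh : measurable_fun setT h) :
  measurable_fun setT Z -> measurable_fun setT w -> (forall x, 0 <= w x) ->
  (forall u, 0 <= h u) ->
  \int[mu]_x (h (Z x) * w x) =
  limn (fun n => \sum_(r \in range (nnsfun_approx measurableT mh n))
     r%:E * \int[mu]_x
       ((\1_(nnsfun_approx measurableT mh n @^-1` [set r]) (Z x))%:E * w x)).
Proof.
move=> mZ mw w0 h0; set g := nnsfun_approx measurableT mh.
have mg n : measurable_fun setT (fun x => (g n (Z x))%:E).
  apply/measurable_EFinP; apply: measurableT_comp => //.
transitivity (\int[mu]_x limn (fun n => (g n (Z x))%:E * w x)).
  apply: eq_integral => x _; apply/esym/cvg_lim => //.
  have cg : (g n (Z x))%:E @[n --> \oo] --> h (Z x).
    by apply: (@cvg_nnsfun_approx _ _ _ _ measurableT _ mh).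
  have ndg : nondecreasing_seq (fun n => (g n (Z x))%:E).
    by move=> m n mn; rewrite lee_fin; exact/lefP/nd_nnsfun_approx.
  exact: ge0_nondecreasing_cvgeMr.
rewrite monotone_convergence//; last 3 first.
- by move=> n; apply: emeasurable_funM.
- by move=> n x _; rewrite mule_ge0 ?lee_fin.
- by move=> x _ m n mn; rewrite lee_wpmul2r// lee_fin; exact/lefP/nd_nnsfun_approx.
congr (limn _); apply/funext => n.
under eq_integral.
  move=> x _; rewrite fimfunE -fsumEFin// ge0_mule_fsuml; last first.
    by move=> r; rewrite lee_fin; exact: nnfun_muleindic_ge0.
  over.
rewrite ge0_integral_fsum//; last 2 first.
- move=> r; apply: emeasurable_funM => //; apply/measurable_EFinP.
  by apply: measurable_funM => //; apply: measurableT_comp.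
- by move=> r x _; rewrite mule_ge0 //; exact: nnfun_muleindic_ge0.
apply: eq_fsbigr => r /[!inE] -[u _ <-].
rewrite -ge0_integralZl//.
- by apply: eq_integral => x _; rewrite EFinM muleA.
- apply: emeasurable_funM => //; apply/measurable_EFinP.
  by apply: measurableT_comp.
- by move=> x _; rewrite mule_ge0 ?lee_fin.
- by rewrite lee_fin.
Qed.

(** Two weighted images that agree on sets agree on nonnegative functions.  The
two source spaces may differ, so that this covers at once the law of a random
variable with a density, the change of variable of a dilation, and the
factorization of the expectation of a product. *)
Lemma ge0_eq_integral_of_sets (R : realType) (d1 d2 dU : measure_display)
    (X1 : measurableType d1) (X2 : measurableType d2) (U : measurableType dU)
    (m1 : {measure set X1 -> \bar R}) (m2 : {measure set X2 -> \bar R})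
    (Z1 : X1 -> U) (Z2 : X2 -> U) (w1 : X1 -> \bar R) (w2 : X2 -> \bar R) :
  measurable_fun setT Z1 -> measurable_fun setT Z2 ->
  measurable_fun setT w1 -> measurable_fun setT w2 ->
  (forall x, 0 <= w1 x) -> (forall x, 0 <= w2 x) ->
  (forall A, measurable A -> \int[m1]_x ((\1_A (Z1 x))%:E * w1 x) =
                             \int[m2]_x ((\1_A (Z2 x))%:E * w2 x)) ->
  forall h : U -> \bar R, measurable_fun setT h -> (forall u, 0 <= h u) ->
  \int[m1]_x (h (Z1 x) * w1 x) = \int[m2]_x (h (Z2 x) * w2 x).
Proof.
move=> mZ1 mZ2 mw1 mw2 w10 w20 m12 h mh h0.
rewrite !(ge0_integral_weighted_approx _ mh)//.
by congr (limn _); apply/funext => n; apply: eq_fsbigr => r _; rewrite m12.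
Qed.

(** The product rule for the full family of arbitrary measurable sets, which
contains the rule for subfamilies: take the whole space outside of them. *)
Definition full_product_rule (R : realType) (dT dU : measure_display)
    (T : measurableType dT) (U : measurableType dU) (P : probability T R)
    (I : finType) (Z : I -> T -> U) : Prop :=
  forall A : I -> set U, (forall i, measurable (A i)) ->
    P [set w | forall i, A i (Z i w)] = \prod_i P (Z i @^-1` A i).

Lemma measurable_rectangle_preimage (dT dU : measure_display)
    (T : measurableType dT) (U : measurableType dU)
    (I : finType) (Z : I -> T -> U) (A : I -> set U) :
  (forall i, measurable_fun setT (Z i)) -> (forall i, measurable (A i)) ->
  measurable [set w | forall i, A i (Z i w)].
Proof.
move=> mZ mA.
have -> : [set w | forall i, A i (Z i w)] = \bigcap_(i in [set: I]) Z i @^-1` A i.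
  by apply/seteqP; split => w /= H i; [move=> _|]; exact: H.
apply: fin_bigcap_measurable => // i _.
by rewrite -[X in measurable X]setTI; exact: mZ.
Qed.

Lemma integral_indic_comp (R : realType) (dT dU : measure_display)
    (T : measurableType dT) (U : measurableType dU)
    (mu : {measure set T -> \bar R}) (Z : T -> U) (A : set U) :
  measurable_fun setT Z -> measurable A ->
  \int[mu]_w (\1_A (Z w))%:E = mu (Z @^-1` A).
Proof.
move=> mZ mA; rewrite -(setIT (Z @^-1` A)) -integral_indic//.
by rewrite -[X in measurable X]setTI; exact: mZ.
Qed.

Lemma measurable_fun_eprod (R : realType) (dT : measure_display)
    (T : measurableType dT) (I : Type) (s : seq I) (p : pred I)
    (h : I -> T -> \bar R) :
  (forall i, measurable_fun setT (h i)) ->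
  measurable_fun setT (fun w => \prod_(i <- s | p i) h i w).
Proof.
move=> mh; elim: s => [|i s IH].
  by under eq_fun do rewrite big_nil; exact: measurable_cst.
under eq_fun do rewrite big_cons.
by case: (p i) => //; exact: emeasurable_funM.
Qed.

Lemma prode_indic (R : realType) (T U : Type) (I : finType) (Z : I -> T -> U)
    (A : I -> set U) (w : T) :
  \prod_i (\1_(A i) (Z i w))%:E =
  (\1_[set w | forall i, A i (Z i w)] w)%:E :> \bar R.
Proof.
rewrite indicE; case: (boolP (w \in _)) => [|/negP wA].
  rewrite inE => wA; apply: big1 => i _; rewrite indicE mem_set//; exact: wA.
have /existsNP[i iA] : ~ (forall i, A i (Z i w)).
  by move=> wA'; apply: wA; rewrite inE.
by rewrite (bigD1 i)//= indicE memNset// mul0e.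
Qed.

(** The indicators are replaced by general functions one index at a time: with
the other factors frozen into a weight [G], the identity for indicators of the
variable [Z k] extends to nonnegative functions of [Z k]. *)
Lemma integral_prod_independent (R : realType) (dT dU : measure_display)
    (T : measurableType dT) (U : measurableType dU) (P : probability T R)
    (I : finType) (Z : I -> T -> U) (h : I -> U -> \bar R) :
  (forall i, measurable_fun setT (Z i)) -> full_product_rule P Z ->
  (forall i, measurable_fun setT (h i)) -> (forall i u, 0 <= h i u) ->
  \int[P]_w \prod_i h i (Z i w) = \prod_i \int[P]_w h i (Z i w).
Proof.
move=> mZ indep mh h0.
(* [s] lists the indices whose factor need not be an indicator. *)
suff : forall (s : seq I) (h : I -> U -> \bar R),
    (forall i, measurable_fun setT (h i)) -> (forall i u, 0 <= h i u) ->
    (forall i, i \notin s ->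
      exists2 A, measurable A & h i = fun u => (\1_A u)%:E) ->
    \int[P]_w \prod_i h i (Z i w) = \prod_i \int[P]_w h i (Z i w).
  move=> /(_ (enum I) h); apply => // i; by rewrite mem_enum.
move=> {h mh h0}; elim => [|k s IH] h mh h0 hs.
  have /choice[A AP] : forall i, exists A,
      measurable A /\ h i = fun u => (\1_A u)%:E.
    by move=> i; have [//|A mA hA] := hs i; exists A.
  have mA i : measurable (A i) by have [] := AP i.
  have hA i u : h i u = (\1_(A i) u)%:E by have [_ ->] := AP i.
  under eq_integral do (under eq_bigr do rewrite hA; rewrite prode_indic).
  rewrite integral_indic//; last first.
    exact: measurable_rectangle_preimage.
  rewrite setIT; apply: eq_trans (indep A mA) _; apply: eq_bigr => i _.
  by under eq_integral do rewrite hA; rewrite integral_indic_comp.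
pose G w := \prod_(i | i != k) h i (Z i w).
pose c := \prod_(i | i != k) \int[P]_w h i (Z i w).
have mhZ i : measurable_fun setT (h i \o Z i) by exact: measurableT_comp.
have mG : measurable_fun setT G by apply: measurable_fun_eprod.
have G0 w : 0 <= G w by exact: prode_ge0.
have c0 : 0 <= c by apply: prode_ge0 => i _; exact: integral_ge0.
have key := @ge0_eq_integral_of_sets R _ _ _ _ _ _ P P (Z k) (Z k) G (cst c)
  (mZ k) (mZ k) mG (measurable_cst _) G0 (fun=> c0) _ (h k) (mh k) (h0 k).
transitivity (\int[P]_w (h k (Z k w) * G w)).
  by apply: eq_integral => w _; rewrite (bigD1 k).
rewrite key.
  rewrite ge0_integralZr//; first by rewrite [RHS](bigD1 k).
  exact: mhZ.
move=> A mA.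
pose h' i := if i == k then fun u => (\1_A u)%:E else h i.
have h'k : h' k = fun u => (\1_A u)%:E by rewrite /h' eqxx.
have h'i i : i != k -> h' i = h i by rewrite /h' => /negbTE ->.
have -> : \int[P]_w ((\1_A (Z k w))%:E * G w) = \int[P]_w \prod_i h' i (Z i w).
  apply: eq_integral => w _; rewrite (bigD1 k)//= h'k; congr (_ * _).
  by apply: eq_bigr => i /h'i ->.
rewrite IH.
- rewrite (bigD1 k)//= h'k ge0_integralZr//.
  + by congr (_ * _); apply: eq_bigr => i /h'i ->.
  + apply/measurable_EFinP; exact: measurableT_comp.
- move=> i; rewrite /h'; case: ifP => // _; exact/measurable_EFinP.
- by move=> i u; rewrite /h'; case: ifP => // _; rewrite lee_fin.
- move=> i is_; have [->|ik] := eqVneq i k; first by exists A.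
  by rewrite h'i//; apply: hs; rewrite inE negb_or ik.
Qed.

End integrals.

(** * Densities of product laws *)

Section change_of_measure.
Local Open Scope ereal_scope.

(** The image under [Z] of the measure with density [w] with respect to [mu]. *)
Definition weighted_image (R : realType) (dX dU : measure_display)
    (X : measurableType dX) (U : measurableType dU)
    (mu : {measure set X -> \bar R}) (Z : X -> U) (w : X -> \bar R)
    (A : set U) : \bar R := \int[mu]_x ((\1_A (Z x))%:E * w x).

Lemma ge0_weighted_image_sigma_additive (R : realType) (dX dU : measure_display)
    (X : measurableType dX) (U : measurableType dU)
    (mu : {measure set X -> \bar R}) (Z : X -> U) (w : X -> \bar R) :
  measurable_fun setT Z -> measurable_fun setT w -> (forall x, 0 <= w x) ->
  semi_sigma_additive (weighted_image mu Z w).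
Proof.
move=> mZ mw w0 F mF tF mUF.
have termE A : measurable A ->
    weighted_image mu Z w A = \int[mu]_(x in Z @^-1` A) w x.
  move=> mA; rewrite [RHS]integral_mkcond; apply: eq_integral => x _.
  by rewrite epatch_indic /= muleC !indicE.
have mZF A : measurable A -> measurable (Z @^-1` A).
  by move=> mA; rewrite -[X in measurable X]setTI; exact: mZ.
rewrite termE// preimage_bigcup ge0_integral_bigcup//; first last.
- apply/trivIsetP => /= i j _ _ ij; rewrite -preimage_setI.
  by move/trivIsetP : tF => /(_ _ _ _ _ ij) ->//; rewrite preimage_set0.
- exact: measurable_funS mw.
- by move=> k; exact: mZF.
under eq_fun do under eq_bigr do rewrite termE//.
by apply: is_cvg_ereal_nneg_natsum_cond => n _ _; exact: integral_ge0.
Qed.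

Section weighted_image_measure.
Context (R : realType) (dX dU : measure_display)
    (X : measurableType dX) (U : measurableType dU)
    (mu : {measure set X -> \bar R}) (Z : X -> U) (w : X -> \bar R).
Hypotheses (mZ : measurable_fun setT Z) (mw : measurable_fun setT w)
  (w0 : forall x, 0 <= w x).

Let weighted_image0 : weighted_image mu Z w set0 = 0.
Proof. by apply: integral0_eq => x _; rewrite indic0 mul0e. Qed.

Let weighted_image_ge0 A : 0 <= weighted_image mu Z w A.
Proof. by apply: integral_ge0 => x _; rewrite mule_ge0// lee_fin. Qed.

Definition weighted_image_measure : {measure set U -> \bar R} :=
  HB.pack (weighted_image mu Z w) (isMeasure.Build _ _ _ (weighted_image mu Z w)
    weighted_image0 weighted_image_ge0
    (ge0_weighted_image_sigma_additive mZ mw w0)).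

End weighted_image_measure.

Lemma eq_weighted_image_of_pi_system (R : realType) (d1 d2 dU : measure_display)
    (X1 : measurableType d1) (X2 : measurableType d2) (U : measurableType dU)
    (m1 : {measure set X1 -> \bar R}) (m2 : {measure set X2 -> \bar R})
    (Z1 : X1 -> U) (Z2 : X2 -> U) (w1 : X1 -> \bar R) (w2 : X2 -> \bar R)
    (G : set (set U)) :
  measurable_fun setT Z1 -> measurable_fun setT Z2 ->
  measurable_fun setT w1 -> measurable_fun setT w2 ->
  (forall x, 0 <= w1 x) -> (forall x, 0 <= w2 x) ->
  measurable = <<s G >> -> setI_closed G -> G setT ->
  \int[m1]_x w1 x < +oo ->
  {in G, weighted_image m1 Z1 w1 =1 weighted_image m2 Z2 w2} ->
  forall A, measurable A -> weighted_image m1 Z1 w1 A = weighted_image m2 Z2 w2 A.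
Proof.
move=> mZ1 mZ2 mw1 mw2 w10 w20 mG GI GT fin eqG.
pose M1 := weighted_image_measure m1 mZ1 mw1 w10.
pose M2 := weighted_image_measure m2 mZ2 mw2 w20.
apply: (@measure_unique _ _ _ G (fun=> setT) mG GI _ _ M1 M2) => //.
- by rewrite bigcup_const.
- by move=> A GA; apply: eqG; rewrite inE.
- move=> _; rewrite /= /weighted_image.
  by under eq_integral do rewrite indicT mul1e.
Qed.

Definition rectangles (I : Type) (d : measure_display) (U : measurableType d) :
    set (set (I -> U)) :=
  [set B | exists2 A : I -> set U, (forall i, measurable (A i)) &
                                   B = [set z | forall i, A i (z i)]].

End change_of_measure.

(** Families indexed by [I] with the product sigma-algebra. *)
Local Notation dataType I U := (g_sigma_algebraType (@rectangles I _ U)).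

Section rectangles.
Local Open Scope ereal_scope.

Lemma setI_closed_rectangles (I : Type) (d : measure_display)
  (U : measurableType d) : setI_closed (@rectangles I d U).
Proof.
move=> _ _ [A mA ->] [B mB ->]; exists (fun i => A i `&` B i).
  by move=> i; exact: measurableI.
by apply/seteqP; split => z /= => [[zA zB] i|zAB]; [|split => i; have [] := zAB i].
Qed.

Lemma measurable_fun_data (I : finType) (d dT : measure_display)
  (T : measurableType dT) (U : measurableType d) (Z : I -> T -> U) :
  (forall i, measurable_fun setT (Z i)) ->
  measurable_fun setT (fun w => (Z ^~ w : dataType I U)).
Proof.
move=> mZ; apply: measurability => // _ [_ [A mA ->] <-].
by rewrite setTI; exact: measurable_rectangle_preimage.
Qed.

Lemma measurable_fun_coordinate (I : finType) (d : measure_display)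
  (U : measurableType d) (i : I) :
  measurable_fun setT (fun z : dataType I U => z i).
Proof.
move=> _ A mA; rewrite setTI; apply: sub_sigma_algebra.
exists (fun j => if j == i then A else setT).
  by move=> j; case: ifP.
apply/seteqP; split => z /=.
  by move=> zA j; case: eqVneq => // ->.
by move=> /(_ i); rewrite eqxx.
Qed.

(** A density [l] of the law of each [Z' i] with respect to the law of [Z i]
yields the density [prod_i l (z i)] of the law of the family [Z'] with respect
to that of [Z]: on rectangles both sides factor by independence, and
rectangles form a generating pi-system. *)
Lemma change_of_product_law (R : realType) (dT dU : measure_display)
    (T : measurableType dT) (U : measurableType dU) (P : probability T R)
    (I : finType) (Z Z' : I -> T -> U) (l : U -> \bar R) :
  (forall i, measurable_fun setT (Z i)) ->
  (forall i, measurable_fun setT (Z' i)) ->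
  full_product_rule P Z -> full_product_rule P Z' ->
  measurable_fun setT l -> (forall u, 0 <= l u) ->
  (forall i A, measurable A ->
     P (Z' i @^-1` A) = \int[P]_w ((\1_A (Z i w))%:E * l (Z i w))) ->
  forall B : set (dataType I U), measurable B ->
    P [set w | B (Z' ^~ w)] =
    \int[P]_w ((\1_B (Z ^~ w))%:E * \prod_i l (Z i w)).
Proof.
move=> mZ mZ' indep indep' ml l0 lE B mB.
pose L w := \prod_i l (Z i w).
have mL : measurable_fun setT L.
  by apply: measurable_fun_eprod => i; exact: measurableT_comp.
have L0 w : 0 <= L w by exact: prode_ge0.
have mZv := measurable_fun_data mZ; have mZ'v := measurable_fun_data mZ'.
transitivity (weighted_image P (fun w => (Z' ^~ w : dataType I U)) (cst 1) B).
  rewrite /weighted_image; under eq_integral do rewrite mule1.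
  by rewrite integral_indic_comp.
rewrite -[RHS]/(weighted_image P (fun w => (Z ^~ w : dataType I U)) L B).
have := @eq_weighted_image_of_pi_system R _ _ _ T T (dataType I U) P P
  (fun w => (Z' ^~ w : dataType I U)) (fun w => (Z ^~ w : dataType I U))
  (cst 1) L (@rectangles I _ U) mZ'v mZv (measurable_cst _) mL
  (fun=> lee01) L0 erefl (@setI_closed_rectangles I _ U).
apply => //.
- by exists (fun=> setT) => //; apply/seteqP; split.
- by rewrite integral_cst// mul1e (@le_lt_trans _ _ 1)// ?probability_le1 ?ltry.
move=> _ /[!inE] -[A mA ->].
rewrite /weighted_image; under eq_integral do rewrite mule1.
rewrite integral_indic_comp//; last by apply: sub_sigma_algebra; exists A.
apply: eq_trans (indep' A mA) _.
under eq_bigr do rewrite lE//.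
have := @integral_prod_independent R _ _ T U P I Z
  (fun i u => (\1_(A i) u)%:E * l u) mZ indep.
move=> <-.
- apply: eq_integral => w _; rewrite big_split /=; congr (_ * _).
  by rewrite prode_indic !indicE.
- move=> i; apply: emeasurable_funM => //; exact/measurable_EFinP.
- by move=> i u; rewrite mule_ge0// lee_fin.
Qed.

End rectangles.

(** * Overlapping laws and disjoint events *)

(** Here [b] is the indicator of an event.  On the event the bound follows from
[2 sqrt x <= t x + 1/t], off the event it is [2 sqrt x <= t + x/t] up to a
nonnegative term. *)
Lemma sqrt_le_two_point (R : rcfType) (t x b : R) : 0 < t -> 0 <= x ->
  b = 0 \/ b = 1 ->
  Num.sqrt x <= 2^-1 * (t * (b * x) + t * (1 - b) + t^-1 * (1 + x)).
Proof.
move=> t0 x0 b01.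
have s0 : 0 <= Num.sqrt x by exact: sqrtr_ge0.
have tV0 : 0 < t^-1 by rewrite invr_gt0.
have tK : t * t^-1 = 1 by rewrite divff ?gt_eqF.
rewrite -[in leRHS](sqr_sqrtr x0); set s := Num.sqrt x in s0 *; set u := t^-1 in tV0 tK *.
rewrite -subr_ge0.
case: b01 => ->.
  have -> : 2^-1 * (t * (0 * s ^+ 2) + t * (1 - 0) + u * (1 + s ^+ 2)) - s =
    2^-1 * (u * (s - t) ^+ 2 + u) + s * (t * u - 1) + 2^-1 * t * (1 - t * u).
    by field.
  rewrite tK !subrr !mulr0 !addr0 mulr_ge0 ?invr_ge0// addr_ge0 ?(ltW tV0)//.
  by rewrite mulr_ge0 ?sqr_ge0 ?ltW.
have -> : 2^-1 * (t * (1 * s ^+ 2) + t * (1 - 1) + u * (1 + s ^+ 2)) - s =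
  2^-1 * (u * (t * s - 1) ^+ 2 + u * s ^+ 2) +
    (s - 2^-1 * t * s ^+ 2) * (t * u - 1).
  by field.
rewrite tK subrr mulr0 addr0 mulr_ge0 ?invr_ge0// addr_ge0//.
  by rewrite mulr_ge0 ?sqr_ge0 ?ltW.
by rewrite mulr_ge0 ?sqr_ge0 ?ltW.
Qed.

Section two_point.
Local Open Scope ereal_scope.

(** Both [P B^c] and the mass of [B] under the law of density [L] are bounded by
[d = 1 - P B].  Integrating [sqrt_le_two_point] gives [c <= t d + 1/t] for all
[t > 0], and [t = 2/c] gives [d >= c^2/4]. *)
Lemma two_point_bound (R : realType) (d : measure_display)
    (T : measurableType d) (P : probability T R) (B : set T) (L : T -> R)
    (c : R) :
  measurable B -> measurable_fun setT L -> (forall w, (0 <= L w)%R) ->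
  (0 < c)%R -> \int[P]_w (L w)%:E <= 1 ->
  P B + \int[P]_w (\1_B w * L w)%:E <= 1 ->
  c%:E <= \int[P]_w (Num.sqrt (L w))%:E ->
  P B <= (1 - c ^+ 2 / 4)%:E.
Proof.
move=> mB mL L0 c0 EL1 PB1 cE.
have mBL : measurable_fun setT (fun w => \1_B w * L w)%R.
  exact: measurable_funM.
have BL0 w : (0 <= \1_B w * L w)%R by rewrite mulr_ge0.
set e := \int[P]_w _ in PB1.
have e0 : 0 <= e by apply: integral_ge0 => w _; rewrite lee_fin.
have [x x0 PBx] : exists2 x : R, (0 <= x)%R & P B = x%:E.
  exists (fine (P B)); first by rewrite fine_ge0.
  by rewrite fineK// fin_num_measure.
have efin : e \is a fin_num.
  rewrite ge0_fin_numE// (le_lt_trans _ (ltry 1))// (le_trans _ PB1)//.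
  by rewrite leeDr// measure_ge0.
have [y y0 ey] : exists2 y : R, (0 <= y)%R & e = y%:E.
  by exists (fine e); rewrite ?fine_ge0// fineK.
have ELfin : \int[P]_w (L w)%:E \is a fin_num.
  rewrite ge0_fin_numE ?(le_lt_trans EL1 (ltry 1))//.
  by apply: integral_ge0 => w _; rewrite lee_fin.
have [z z0 ELz] : exists2 z : R, (0 <= z)%R & \int[P]_w (L w)%:E = z%:E.
  exists (fine (\int[P]_w (L w)%:E)); rewrite ?fineK// fine_ge0//.
  by apply: integral_ge0 => w _; rewrite lee_fin.
pose t : R := (2 / c)%R.
have t0 : (0 < t)%R by rewrite divr_gt0.
have main : c%:E <= (2^-1 * (t * y + t * (1 - x) + t^-1 * (1 + z)))%:E.
  apply: (le_trans cE).
  have -> : (2^-1 * (t * y + t * (1 - x) + t^-1 * (1 + z)))%:E =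
    \int[P]_w (2^-1 * (t * (\1_B w * L w) + t * \1_(~` B) w +
                      t^-1 * (cst 1%R w + L w)))%:E.
    have mBc : measurable_fun setT (\1_(~` B) : T -> R).
      by apply: measurable_indic; exact: measurableC.
    have ID (f g : T -> R) : measurable_fun setT f -> measurable_fun setT g ->
        (forall w, 0 <= f w)%R -> (forall w, 0 <= g w)%R ->
        \int[P]_w (f w + g w)%:E = \int[P]_w (f w)%:E + \int[P]_w (g w)%:E.
      move=> mf mg f0 g0; under eq_integral do rewrite EFinD.
      by rewrite ge0_integralD//; (try by move=> w _; rewrite lee_fin);
        exact/measurable_EFinP.
    have IZ (k : R) (f : T -> R) : measurable_fun setT f ->
        (forall w, 0 <= f w)%R -> (0 <= k)%R ->
        \int[P]_w (k * f w)%:E = k%:E * \int[P]_w (f w)%:E.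
      move=> mf f0 k0; under eq_integral do rewrite EFinM.
      by rewrite ge0_integralZl_EFin//; (try by move=> w _; rewrite lee_fin);
        exact/measurable_EFinP.
    have PBc : \int[P]_w (\1_(~` B) w)%:E = (1 - x)%:E.
      rewrite integral_indic ?setIT//; last exact: measurableC.
      by apply: eq_trans (probability_setC P mB) _; rewrite PBx EFinB.
    have P1 : \int[P]_w (cst 1%R w)%:E = 1.
      by rewrite -[RHS](probability_setT P) -[RHS]mul1e -integral_cst.
    have tB0 w : (0 <= t * (\1_B w * L w))%R by rewrite mulr_ge0 ?(ltW t0).
    have tBc0 w : (0 <= t * \1_(~` B) w :> R)%R by rewrite mulr_ge0 ?(ltW t0).
    have t10 w : (0 <= t^-1 * (cst 1 w + L w))%R.
      by rewrite mulr_ge0 ?invr_ge0 ?(ltW t0)// addr_ge0.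
    have mtB : measurable_fun setT (fun w => t * (\1_B w * L w))%R.
      exact: measurable_funM.
    have mtBc : measurable_fun setT (fun w => t * \1_(~` B) w : R)%R.
      exact: measurable_funM.
    have m1L : measurable_fun setT (fun w => cst 1 w + L w)%R.
      exact: measurable_funD.
    have mt1 : measurable_fun setT (fun w => t^-1 * (cst 1 w + L w))%R.
      exact: measurable_funM.
    have mtt : measurable_fun setT
        (fun w => t * (\1_B w * L w) + t * \1_(~` B) w)%R.
      exact: measurable_funD.
    have t1L w : (0 <= cst 1 w + L w)%R by rewrite addr_ge0.
    rewrite IZ//; first last.
    - by move=> w; rewrite !addr_ge0.
    - exact: measurable_funD.
    rewrite ID//; last by move=> w; rewrite addr_ge0.
    rewrite ID// !IZ ?invr_ge0 ?(ltW t0)//.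
    rewrite (ID (cst 1%R))//.
    by rewrite -/e ey PBc P1 ELz !EFinM !EFinD !EFinM EFinD.
  apply: ge0_le_integral => //.
  - apply/measurable_EFinP; apply: measurableT_comp => //.
    by apply: continuous_measurable_fun; exact: sqrt_continuous.
  - apply/measurable_EFinP; apply: measurable_funM => //.
    have mBc : measurable_fun setT (\1_(~` B) : T -> R).
      by apply: measurable_indic; exact: measurableC.
    apply: measurable_funD; last first.
      by apply: measurable_funM => //; exact: measurable_funD.
    by apply: measurable_funD; exact: measurable_funM.
  - move=> w _; rewrite lee_fin.
    have -> : \1_(~` B) w = (1 - \1_B w)%R :> R.
      by rewrite !indicE in_setC; case: (w \in B); rewrite ?subrr ?subr0.
    apply: sqrt_le_two_point => //.
    by rewrite indicE; case: (w \in B); [right|left].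
rewrite PBx lee_fin; rewrite ELz lee_fin in EL1.
move: PB1; rewrite PBx ey -EFinD lee_fin => xy.
move: main; rewrite lee_fin => main.
have tc : (t * c = 2)%R by rewrite divfK ?gt_eqF.
have tV : (t^-1 = c / 2)%R by rewrite invf_div.
rewrite tV in main.
have h1 : (c <= t * (1 - x) + c / 2)%R.
  apply: (le_trans main).
  have : (t * y <= t * (1 - x))%R by rewrite ler_wpM2l ?(ltW t0)//; lra.
  have : (c / 2 * (1 + z) <= c)%R.
    have c20 : (0 <= c / 2)%R by rewrite divr_ge0 ?(ltW c0).
    have z2 : (1 + z <= 2)%R by lra.
    have := ler_wpM2l c20 z2; lra.
  lra.
have h2 : (c * c <= c * (t * (1 - x) + c / 2))%R by rewrite ler_wpM2l ?(ltW c0).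
have h3 : (c * (t * (1 - x) + c / 2) = (t * c) * (1 - x) + c * c / 2)%R by ring.
rewrite h3 tc in h2; rewrite expr2; lra.
Qed.

End two_point.

(** * Dilation of the real line *)

Section scaling.
Context (R : realType).
Local Open Scope ereal_scope.
Local Notation leb := (@lebesgue_measure R).

(** Both sides are measures in [A] which agree on half-open intervals. *)
Lemma lebesgue_measure_scale (c : R) (A : set R) : (0 < c)%R -> measurable A ->
  leb A = \int[leb]_x ((\1_A (c * x)%R)%:E * c%:E).
Proof.
move=> c0 mA.
have mc : measurable_fun [set: R] (fun x : R => (c * x)%R).
  exact: measurable_funM.
have cE0 (x : measurableTypeR R) : 0 <= cst c%:E x by rewrite lee_fin ltW.
pose M : {measure set (measurableTypeR R) -> \bar R} :=
  @weighted_image_measure R _ _ (measurableTypeR R) (measurableTypeR R) leb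
    (fun x : R => (c * x)%R) _ mc (measurable_cst c%:E) cE0.
suff H : forall X, ocitv X -> leb X = M X.
  exact: (lebesgue_measure_unique H mA).
move=> _ [[a b]] _ <-.
rewrite /M /= /weighted_image ge0_integralZr//; last 2 first.
- apply/measurable_EFinP; apply: measurableT_comp => //.
- by rewrite lee_fin ltW.
rewrite integral_indic_comp//.
have -> : (fun x : R => (c * x)%R) @^-1` [set` `]a, b]] =
    [set` `](c^-1 * a)%R, (c^-1 * b)%R]].
  apply/seteqP; split => x /=; rewrite !in_itv /=.
    by move=> /andP[ax xb]; rewrite ltr_pdivrMl// ler_pdivlMl// ax xb.
  by rewrite ltr_pdivrMl// ler_pdivlMl.
have lebE (x y : R) : leb [set` `]x, y]] = if (x < y)%R then (y - x)%:E else 0.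
  by apply: eq_trans (lebesgue_measure_itv _) _; rewrite /= lte_fin EFinB.
rewrite lebE [X in _ = X * _](lebE _ _) ltr_pM2l ?invr_gt0//.
case: ifP => _; last by rewrite mul0e.
rewrite -EFinM; congr EFin; field; exact: lt0r_neq0.
Qed.

Lemma ge0_integral_scale (c : R) (h : R -> \bar R) : (0 < c)%R ->
  measurable_fun setT h -> (forall x, 0 <= h x) ->
  \int[leb]_x h x = \int[leb]_x (h (c * x)%R * c%:E).
Proof.
move=> c0 mh h0.
transitivity (\int[leb]_x (h x * cst 1 x)).
  by apply: eq_integral => x _; rewrite mule1.
apply: (@ge0_eq_integral_of_sets R _ _ _ _ _ _ leb leb id
  (fun x => c * x)%R (cst 1) (cst c%:E)) => //.
- exact: measurable_funM.
- by move=> x; rewrite lee_fin ltW.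
- move=> A mA; rewrite -lebesgue_measure_scale//.
  by under eq_integral do rewrite mule1; rewrite integral_indic// setIT.
Qed.

Lemma integral_oneDsqrV_lty : \int[leb]_x ((@oneDsqr R x)^-1)%:E < +oo.
Proof.
rewrite ge0_symfun_integralT//=.
- rewrite -set_itvcy.
  by rewrite integral0y_oneDsqr -EFinM ltry.
- exact: continuous_oneDsqrV.
- by move=> x; rewrite /= /oneDsqr sqrrN.
Qed.

End scaling.

(** * Hellinger affinity of a density with its dilation *)

Section density_class.
Context (R : realType).

Lemma superpolynomial_growth_ge (g : R -> R) (k : nat) :
  superpolynomial_growth g ->
  exists2 B : R, 1 <= B & forall x, B < `|x| -> `|x| ^+ k <= g x.
Proof.
move=> /(_ k)[/cvgryPge/(_ 1)[N1 [_ hN1]] /cvgryPge/(_ 1)[N2 [_ hN2]]].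
exists (Num.max 1 (Num.max N1 (- N2))); first by rewrite le_max lexx.
move=> x; rewrite !gt_max => /and3P[x1 xN1 xN2].
have x0 : 0 < `|x| ^+ k by rewrite exprn_gt0// (lt_trans ltr01).
suff : 1 <= g x / `|x| ^+ k by rewrite ler_pdivlMr// mul1r.
have [xge0|xlt0] := leP 0 x.
  by apply: hN1; rewrite -(ger0_norm xge0).
by apply: hN2; rewrite ltr0_norm// in xN2; rewrite -ltrN2.
Qed.

(** The factor of [1 + y^2] is four times the square of the derivative, at
[s = 0], of the square root of the dilated density [e^(-s) f (e^(-s) y)].
Outside of a large interval the growth conditions bound the product by
[2 (1 + |C|)^2 |y|^(2m+4) e^(-V y)]; inside, it is continuous. *)
Lemma score_decay (V : R -> R) :
  smooth V -> polynomial_growth (derive1 V) ->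
  superpolynomial_growth (fun x => expR (V x)) ->
  exists2 K : R, 0 <= K &
    forall y, oneDsqr y * ((1 - y * derive1 V y) ^+ 2 * expR (- V y)) <= K.
Proof.
move=> sV [C [M [m gV]]] /(superpolynomial_growth_ge (2 * m + 4))[B B1 hB].
pose phi y := oneDsqr y * ((1 - y * derive1 V y) ^+ 2 * expR (- V y)).
have cV : continuous V.
  by move=> x; exact/differentiable_continuous/derivable1_diffP/(sV 0%N x).
have cV' : continuous (derive1 V).
  by move=> x; exact/differentiable_continuous/derivable1_diffP/(sV 1%N x).
have cphi : continuous phi.
  have cu : continuous (fun y : R => 1 - y * derive1 V y).
    by move=> x; apply: cvgB; [exact: cvg_cst|apply: cvgM; [exact: cvg_id|exact: cV']].
  have cNV : continuous (fun y : R => - V y) by move=> x; apply: cvgN; exact: cV.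
  move=> x; apply: cvgM; first exact: continuous_oneDsqr.
  apply: cvgM.
    exact: (continuous_comp (cu x) (@exprn_continuous _ 2 _)).
  exact: (continuous_comp (cNV x) (@continuous_expR _ _)).
pose b := Num.max B M.
have b0 : 0 <= b by rewrite le_max (le_trans ler01 B1).
have bb : - b <= b by rewrite (@le_trans _ _ 0)// oppr_le0.
have [c _ hc] : exists2 c, c \in `[- b, b]%R &
    forall t, t \in `[- b, b]%R -> phi t <= phi c.
  by apply: EVT_max => //; exact: continuous_subspaceT.
have phi0 y : 0 <= phi y.
  apply: mulr_ge0; first exact: (le_trans ler01 (oneDsqr_ge1 y)).
  by rewrite mulr_ge0 ?sqr_ge0 ?expR_ge0.
exists (Num.max (phi c) (2 * (1 + `|C|) ^+ 2)); first by rewrite le_max phi0.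
move=> y; rewrite -/(phi y) le_max; have [yb|] := leP `|y| b.
  by rewrite hc// in_itv /= -ler_norml.
rewrite gt_max => /andP[By My]; apply/orP; right.
have hVy := hB y By.
have Vy' := gV y (ltW My).
rewrite /phi.
set v := derive1 V y in Vy' *; set a := `|y| in hVy By Vy' *.
have a1 : 1 <= a by rewrite (le_trans B1) ?ltW.
have a0 : 0 <= a by rewrite (le_trans ler01).
have h1 : `|1 - y * v| <= (1 + `|C|) * a ^+ m.+1.
  rewrite (le_trans (ler_normB _ _))// normr1 normrM -/a mulrDl mul1r lerD//.
    by rewrite exprn_ege1.
  rewrite exprS mulrCA ler_wpM2l// (le_trans Vy')// ler_wpM2r ?exprn_ge0//.
  exact: ler_norm.
have h2 : (1 - y * v) ^+ 2 <= (1 + `|C|) ^+ 2 * a ^+ (2 * m + 2).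
  rewrite -[leLHS]real_normK ?num_real// (_ : 2 * m + 2 = m.+1 * 2)%N; last by lia.
  by rewrite exprM -exprMn lerXn2r ?nnegrE// (le_trans _ h1).
have h3 : oneDsqr y <= 2 * a ^+ 2.
  rewrite /oneDsqr -[y ^+ 2]real_normK ?num_real// -/a.
  have : 1 <= a ^+ 2 by rewrite exprn_ege1.
  lra.
have h4 : a ^+ (2 * m + 4) * expR (- V y) <= 1.
  by rewrite expRN ler_pdivrMr ?expR_gt0// mul1r.
apply: (@le_trans _ _ ((2 * a ^+ 2) *
    (((1 + `|C|) ^+ 2 * a ^+ (2 * m + 2)) * expR (- V y)))).
  apply: ler_pM; last 2 first.
  - exact: h3.
  - by rewrite ler_wpM2r// expR_ge0.
  - exact: (le_trans ler01 (oneDsqr_ge1 y)).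
  - by rewrite mulr_ge0 ?sqr_ge0 ?expR_ge0.
rewrite (_ : _ * _ =
  2 * (1 + `|C|) ^+ 2 * (a ^+ (2 * m + 4) * expR (- V y))); last first.
  by rewrite (_ : 2 * m + 4 = 2 + (2 * m + 2))%N ?(exprD a 2 (2 * m + 2)); [ring|lia].
by rewrite ler_piMr// mulr_ge0// sqr_ge0.
Qed.

End density_class.

Section hellinger.
Context (R : realType).

Lemma is_derive_sqrt_scaled_density (V : R -> R) (x t : R) :
  (forall y, derivable V y 1) ->
  is_derive t (1 : R) (fun t => expR (- ((t + V (expR (- t) * x)) / 2)))
    (expR (- ((t + V (expR (- t) * x)) / 2)) *
     (- ((1 - expR (- t) * x * derive1 V (expR (- t) * x)) / 2))).
Proof.
move=> dV.
have dVy y : is_derive y (1 : R) V (derive1 V y).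
  by rewrite derive1E; exact: derivableP.
have d1 : is_derive t (1 : R) (fun t : R => expR (- t) * x) (- (expR (- t) * x)).
  rewrite (_ : (fun t => _) = x \*: (expR \o -%R)); last first.
    by apply/funext => u /=; rewrite mulrC.
  apply: is_derive_eq.
  by rewrite /GRing.scale /= mulrN1 mulrN mulrC.
have d2 : is_derive t (1 : R) (V \o (fun t => expR (- t) * x))
    (derive1 V (expR (- t) * x) * - (expR (- t) * x)).
  exact: is_derive1_comp.
have d3 : is_derive t (1 : R)
    (- (2^-1 \*: (id + (V \o (fun t => expR (- t) * x)))))
    (- (2^-1 *: (1 + derive1 V (expR (- t) * x) * - (expR (- t) * x)))).
  by apply: is_derive_eq.
rewrite (_ : (fun t => _) =
  expR \o (- (2^-1 \*: (id + (V \o (fun t => expR (- t) * x)))))); last first.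
  by apply/funext => u /=; rewrite mulrC.
apply: is_derive_eq; rewrite /= /GRing.scale /=.
congr (expR _ * _); last by field.
by rewrite -[LHS]/(- (2^-1 * (t + V (expR (- t) * x)))) mulrC.
Qed.

(** With [r] the square root of the dilated density, this is
[(r s)^2 + (r 0)^2 = 2 r s r 0 + (r s - r 0)^2], where the last square is
estimated by the mean value theorem.  The factor [e^1] is the cost of
replacing [1 + y^2] at the intermediate point [y = e^(-xi) x] by [1 + x^2]. *)
Lemma scaled_density_le (V : R -> R) (K : R) :
  (forall y, derivable V y 1) ->
  (forall y, oneDsqr y * ((1 - y * derive1 V y) ^+ 2 * expR (- V y)) <= K) ->
  forall s x, 0 <= s <= 1 ->
  expR (- s) * expR (- V (expR (- s) * x)) + expR (- V x) <=
  2 * Num.sqrt (expR (- s) * expR (- V (expR (- s) * x)) * expR (- V x)) +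
  K * expR 1 / 4 * s ^+ 2 * (oneDsqr x)^-1.
Proof.
move=> dV hK s x /andP[s0 s1].
pose r (t : R) : R := expR (- ((t + V (expR (- t) * x)) / 2)).
pose y (t : R) : R := expR (- t) * x.
pose dr (t : R) : R := r t * (- ((1 - y t * derive1 V (y t)) / 2)).
have rE t : r t ^+ 2 = expR (- t) * expR (- V (y t)).
  by rewrite /r -expRM_natl -expRD; congr expR; rewrite /y; field.
have r0E : r 0 ^+ 2 = expR (- V x).
  by rewrite rE oppr0 expR0 mul1r /y oppr0 expR0 mul1r.
have r0 t : 0 <= r t by exact: expR_ge0.
have [xi] : exists2 xi, xi \in `[0, s]%R & r s - r 0 = dr xi * (s - 0).
  apply: MVT_segment => // [t _|]; first exact: is_derive_sqrt_scaled_density.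
  apply: continuous_subspaceT => t.
  apply/differentiable_continuous/derivable1_diffP.
  by have [] := is_derive_sqrt_scaled_density x t dV.
rewrite in_itv /= => /andP[xi0 xis]; rewrite subr0 => rs.
have o0 z : 0 < oneDsqr z :> R by exact: (lt_le_trans ltr01 (oneDsqr_ge1 z)).
have drE : oneDsqr x * dr xi ^+ 2 <= K * expR 1 / 4.
  have -> : dr xi ^+ 2 =
      4^-1 * (expR (- xi) * ((1 - y xi * derive1 V (y xi)) ^+ 2 * expR (- V (y xi)))).
    by rewrite /dr exprMn rE; field.
  have ox : oneDsqr x <= expR xi ^+ 2 * oneDsqr (y xi).
    rewrite /oneDsqr /y mulrDr mulr1 exprMn mulrA -exprMn -expRD subrr expR0.
    rewrite expr1n mul1r lerD2r exprn_ege1// -expR0 ler_expR//.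
  have := hK (y xi); set q := (_ ^+ 2 * _) => hq.
  have q0 : 0 <= q by rewrite mulr_ge0 ?sqr_ge0 ?expR_ge0.
  have h1 : oneDsqr x * q <= expR xi ^+ 2 * K.
    apply: (@le_trans _ _ (expR xi ^+ 2 * oneDsqr (y xi) * q)).
      exact: ler_wpM2r.
    by rewrite -mulrA ler_wpM2l// sqr_ge0.
  have K0 : 0 <= K by rewrite (le_trans _ hq)// mulr_ge0// ltW.
  have h2 : expR (- xi) * (oneDsqr x * q) <= expR 1 * K.
    apply: (@le_trans _ _ (expR (- xi) * (expR xi ^+ 2 * K))).
      by rewrite ler_wpM2l// expR_ge0.
    rewrite mulrA expr2 mulrA -expRD addNr expR0 mul1r ler_wpM2r//.
    by rewrite ler_expR (le_trans xis).
  lra.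
have -> : expR (- s) * expR (- V (expR (- s) * x)) * expR (- V x) = (r s * r 0) ^+ 2.
  by rewrite exprMn rE r0E.
rewrite sqrtr_sqr ger0_norm ?mulr_ge0// -rE -r0E.
have -> : r s ^+ 2 + r 0 ^+ 2 = 2 * (r s * r 0) + (r s - r 0) ^+ 2 by ring.
rewrite lerD2l rs exprMn [leRHS]mulrAC ler_wpM2r ?sqr_ge0//.
by rewrite ler_pdivlMr// mulrC.
Qed.

End hellinger.

Section hellinger_integral.
Context (R : realType).
Local Notation leb := (@lebesgue_measure R).
Local Open Scope ereal_scope.

(** The pointwise bound [scaled_density_le] is integrated; both densities on its
left-hand side have total mass [1]. *)
Lemma hellinger_affinity_scale (f : R -> R) : class_P1 f ->
  exists2 C : R, (0 <= C)%R & forall s, (0 <= s <= 1)%R ->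
  (1 - C * s ^+ 2)%:E <=
  \int[leb]_x (Num.sqrt (expR (- s) * f (expR (- s) * x) * f x))%:E.
Proof.
move=> [V [-> If sV gV eV]].
have [K K0 hK] := score_decay sV (gV 1%N) eV.
have dV : forall y, derivable V y 1%R by exact: (sV 0%N).
have cV : continuous V.
  by move=> x; exact/differentiable_continuous/derivable1_diffP/dV.
have mf : measurable_fun [set: R] (fun x => expR (- V x)).
  apply: measurableT_comp => //; apply: measurableT_comp => //.
  exact: continuous_measurable_fun.
have [j j0 jE] : exists2 j : R, (0 <= j)%R &
    \int[leb]_x ((@oneDsqr R x)^-1)%:E = j%:E.
  exists (fine (\int[leb]_x ((@oneDsqr R x)^-1)%:E)).
    by rewrite fine_ge0// integral_ge0// => x _; rewrite lee_fin invr_ge0.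
  rewrite fineK// ge0_fin_numE ?integral_oneDsqrV_lty//.
  by rewrite integral_ge0// => x _; rewrite lee_fin invr_ge0.
exists (K * expR 1 / 8 * j)%R.
  by rewrite mulr_ge0// divr_ge0// mulr_ge0// expR_ge0.
move=> s s01; set fs := fun x => (expR (- s) * expR (- V (expR (- s) * x)))%R.
have mfs : measurable_fun [set: R] fs.
  apply: measurable_funM => //.
  have mc : measurable_fun [set: R] (fun x => expR (- s) * x)%R.
    exact: measurable_funM.
  exact: (measurableT_comp mf mc).
have fs0 x : (0 <= fs x)%R by rewrite /fs mulr_ge0 ?expR_ge0.
have Ifs : \int[leb]_x (fs x)%:E = 1.
  rewrite -If [RHS](@ge0_integral_scale R (expR (- s)))//.
  - by apply: eq_integral => x _; rewrite -EFinM mulrC.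
  - exact: expR_gt0.
  - exact/measurable_EFinP.
pose k := (K * expR 1 / 4 * s ^+ 2)%R.
have k0 : (0 <= k)%R 
  by apply: mulr_ge0 (sqr_ge0 s); rewrite divr_ge0// mulr_ge0// expR_ge0.
set h := fun x => Num.sqrt (fs x * expR (- V x)).
have mh : measurable_fun [set: R] h.
  apply: measurableT_comp; last exact: measurable_funM.
  by apply: continuous_measurable_fun; exact: sqrt_continuous.
have mo : measurable_fun [set: R] (fun x => (oneDsqr x)^-1)%R.
  by apply: continuous_measurable_fun; exact: continuous_oneDsqrV.
have : \int[leb]_x ((fs x)%:E + (expR (- V x))%:E) <=
    \int[leb]_x (2%:E * (h x)%:E + k%:E * ((oneDsqr x)^-1)%:E).
  apply: ge0_le_integral => //.
  - by move=> x _; rewrite adde_ge0 ?lee_fin ?expR_ge0.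
  - by apply: emeasurable_funD; exact/measurable_EFinP.
  - by apply: emeasurable_funD; apply: emeasurable_funM => //; exact/measurable_EFinP.
  - by move=> x _; rewrite -!EFinM -!EFinD lee_fin; exact: scaled_density_le.
have h0 x : 0 <= (h x)%:E by rewrite lee_fin sqrtr_ge0.
have o0 x : 0 <= ((@oneDsqr R x)^-1)%:E by rewrite lee_fin invr_ge0.
rewrite ge0_integralD//; try (by move=> x _; rewrite lee_fin ?fs0 ?expR_ge0);
  try exact/measurable_EFinP.
rewrite ge0_integralD//; last 4 first.
- by move=> x _; rewrite mule_ge0.
- by apply: emeasurable_funM => //; exact/measurable_EFinP.
- by move=> x _; rewrite mule_ge0.
- by apply: emeasurable_funM => //; exact/measurable_EFinP.
rewrite ge0_integralZl_EFin//; last exact/measurable_EFinP.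
rewrite ge0_integralZl_EFin//; last exact/measurable_EFinP.
rewrite Ifs If jE.
case: (\int[leb]_x (h x)%:E) => [r| |]; rewrite ?leey//.
  rewrite -!EFinM -!EFinD !lee_fin /k => H.
  have -> : (K * expR 1 / 8 * j * s ^+ 2 =
    (K * expR 1 / 4 * s ^+ 2 * j) / 2)%R by field.
  lra.
by rewrite gt0_muleNy ?lte_fin// addNye leeNy_eq.
Qed.

End hellinger_integral.

(** * Homogeneous statistics of independent coordinates *)

Section auxiliary.
Context (R : realType).

Lemma bernoulli_ineq (x : R) (n : nat) : 0 <= x <= 1 ->
  1 - n%:R * x <= (1 - x) ^+ n.
Proof.
move=> /andP[x0 x1]; elim: n => [|n IH]; first by rewrite mul0r subr0 expr0.
rewrite exprS.
have h1 : 0 <= 1 - x by rewrite subr_ge0.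
have := ler_wpM2l h1 IH; apply: le_trans.
have : 0 <= n%:R * (x * x) by rewrite !mulr_ge0.
rewrite -natr1; lra.
Qed.

Lemma sqrt_prod (I : finType) (x : I -> R) : (forall i, 0 <= x i) ->
  Num.sqrt (\prod_i x i) = \prod_i Num.sqrt (x i).
Proof.
move=> x0.
suff [] : Num.sqrt (\prod_i x i) = \prod_i Num.sqrt (x i) /\ 0 <= \prod_i x i by [].
elim/big_rec2 : _ => [|i y z _ [yz z0]]; first by rewrite sqrtr1 ler01.
by rewrite sqrtrM// yz mulr_ge0.
Qed.

Local Open Scope ereal_scope.
Lemma expr_le_prode (I : finType) (x : R) (y : I -> \bar R) :
  (0 <= x)%R -> (forall i, x%:E <= y i) ->
  (x ^+ #|I|)%:E <= \prod_i y i.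
Proof.
move=> x0 xy.
rewrite -prodr_const -prodEFin.
suff [] : \prod_(i in I) x%:E <= \prod_i y i /\ 0 <= \prod_(i in I) x%:E by [].
elim/big_rec2 : _ => [|i u v _ [uv v0]]; first by rewrite lexx lee01.
by rewrite lee_pmul// mule_ge0// lee_fin.
Qed.

Lemma ge0_integral_of_density (d : measure_display)
    (T : measurableType d) (P : probability T R) (X : T -> R) (f : R -> R) :
  measurable_fun setT X -> measurable_fun setT f -> (forall x, (0 <= f x)%R) ->
  has_density P X f ->
  forall h : R -> \bar R, measurable_fun setT h -> (forall x, 0 <= h x) ->
  \int[P]_w h (X w) = \int[lebesgue_measure]_x (h x * (f x)%:E).
Proof.
move=> mX mf f0 Xf h mh h0.
transitivity (\int[P]_w (h (X w) * cst 1 w)).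
  by apply: eq_integral => w _; rewrite mule1.
apply: (@ge0_eq_integral_of_sets R _ _ _ _ _ _ P lebesgue_measure X
  id (cst 1) (EFin \o f)) => //.
- exact/measurable_EFinP.
move=> A mA; under eq_integral do rewrite mule1.
rewrite integral_indic_comp//; apply: eq_trans (Xf A mA) _.
rewrite [LHS]integral_mkcond.
by apply: eq_integral => x _; rewrite epatch_indic /= muleC.
Qed.

End auxiliary.

Section scale_family.
Context (R : realType).
Local Open Scope ereal_scope.

Lemma measurable_fun_inv_pos (dT : measure_display) (T : measurableType dT)
    (f : T -> R) :
  measurable_fun setT f -> (forall x, (0 < f x)%R) ->
  measurable_fun setT (fun x => (f x)^-1)%R.
Proof.
move=> mf f0; rewrite (_ : (fun x => _) = (@powR R ^~ (-1)%R) \o f).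
  by apply: measurableT_comp => //; exact: measurable_powR.
by apply/funext => x; rewrite /= powR_inv1// ltW.
Qed.

Lemma full_product_rule_comp (dT : measure_display) (T : measurableType dT)
    (P : probability T R) (I : finType) (Z : I -> T -> R) (g : R -> R) :
  measurable_fun setT g -> full_product_rule P Z ->
  full_product_rule P (fun i w => g (Z i w)).
Proof.
move=> mg indep A mA; apply: (indep (fun i => g @^-1` A i)) => i.
by rewrite -[X in measurable X]setTI; exact: mg.
Qed.

(** The dilated variable has density [e^(-s) f (e^(-s) x)]; dividing it by [f x]
gives the density of its law with respect to the law of [X]. *)
Lemma prob_scale_density (dT : measure_display) (T : measurableType dT)
    (P : probability T R) (X : T -> R) (f : R -> R) (s : R) (A : set R) :
  measurable_fun setT X -> measurable_fun setT f -> (forall x, (0 < f x)%R) ->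
  has_density P X f -> measurable A ->
  P ((fun w => (expR s * X w)%R) @^-1` A) =
  \int[P]_w ((\1_A (X w))%:E *
    (expR (- s) * f (expR (- s) * X w) / f (X w))%:E).
Proof.
move=> mX mf f0 Xf mA.
have f0' x : (0 <= f x)%R by exact: ltW.
have mc (c : R) : measurable_fun [set: R] (fun x : R => (c * x)%R).
  exact: measurable_funM.
have mfs : measurable_fun [set: R] (fun x => expR (- s) * f (expR (- s) * x))%R.
  by apply: measurable_funM => //; exact: (measurableT_comp mf (mc _)).
have mfV : measurable_fun [set: R] (fun x => (f x)^-1)%R.
  exact: measurable_fun_inv_pos.
have m1 : measurable_fun [set: R] (fun x => (\1_A x)%:E : \bar R).
  exact/measurable_EFinP.
rewrite -(integral_indic_comp P (Z := fun w => (expR s * X w)%R))//; last first.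
  exact: measurable_funM.
rewrite (ge0_integral_of_density mX mf f0' Xf
  (h := fun x => (\1_A (expR s * x)%R)%:E)); last 2 first.
- exact: (measurableT_comp m1 (mc _)).
- by move=> x; rewrite lee_fin.
rewrite (ge0_integral_of_density mX mf f0' Xf
  (h := fun x => (\1_A x)%:E * (expR (- s) * f (expR (- s) * x) / f x)%:E));
  last 2 first.
- apply: emeasurable_funM => //; apply/measurable_EFinP.
  exact: measurable_funM.
- by move=> x; rewrite mule_ge0 ?lee_fin// divr_ge0// mulr_ge0// expR_ge0.
rewrite [RHS](@ge0_integral_scale R (expR s)); last 3 first.
- exact: expR_gt0.
- apply: emeasurable_funM; last exact/measurable_EFinP.
  apply: emeasurable_funM => //; apply/measurable_EFinP.
  exact: measurable_funM.
- move=> x; apply: mule_ge0; last by rewrite lee_fin.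
  apply: mule_ge0; first by rewrite lee_fin.
  by rewrite lee_fin divr_ge0// mulr_ge0// expR_ge0.
apply: eq_integral => x _; rewrite -!EFinM; congr EFin.
have fx : (f (expR s * x) != 0)%R by exact: lt0r_neq0.
have es : (expR s != 0)%R by rewrite lt0r_neq0// expR_gt0.
have -> : (expR (- s) * (expR s * x) = x)%R by rewrite expRN mulKf.
by rewrite expRN; field; rewrite es fx.
Qed.

End scale_family.

Section homogeneous.
Context (R : realType).
Local Open Scope ereal_scope.

(** The abstract form of the result: the logarithm of a measurable statistic,
homogeneous of degree [m], cannot be concentrated on an interval shorter than
the shift [ms] that it undergoes when the data are dilated by [e^s], as long
as [s] is so small that the two product laws have affinity at least [1/2]. *)
Lemma prob_homogeneous_statistic_le (f : R -> R) (C : R)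
    (dT : measure_display) (T : measurableType dT) (P : probability T R)
    (I : finType) (Z : I -> T -> R) (D : dataType I R -> R) (m : nat)
    (s a b : R) :
  measurable_fun setT f -> (forall x, (0 < f x)%R) ->
  (1 - C * s ^+ 2)%:E <=
    \int[lebesgue_measure]_x
      (Num.sqrt (expR (- s) * f (expR (- s) * x) * f x))%:E ->
  (0 <= C * s ^+ 2)%R -> (0 < #|I|)%N -> (#|I|%:R * (C * s ^+ 2) <= 2^-1)%R ->
  (forall i, measurable_fun setT (Z i)) -> full_product_rule P Z ->
  (forall i, has_density P (Z i) f) ->
  measurable_fun setT D ->
  (forall c z, D (fun i => c * z i)%R = (c ^+ m * D z)%R) ->
  (b - a < m%:R * s)%R ->
  P [set w | (expR a <= D (Z ^~ w) <= expR b)%R] <= (1 - 16^-1)%:E.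
Proof.
move=> mf f0 affinity C0 I0 NC mZ indep fZ mD homD abs.
have f0' x : (0 <= f x)%R by exact: ltW.
pose Z' i w := (expR s * Z i w)%R.
have mc (c : R) : measurable_fun [set: R] (fun x : R => (c * x)%R).
  exact: measurable_funM.
have mZ' i : measurable_fun setT (Z' i) by exact: (measurableT_comp (mc _) (mZ i)).
have indep' : full_product_rule P Z' by exact: full_product_rule_comp.
pose l u := (expR (- s) * f (expR (- s) * u) / f u)%R.
have l0 u : (0 <= l u)%R by rewrite divr_ge0// mulr_ge0// expR_ge0.
have mfs : measurable_fun [set: R] (fun x => expR (- s) * f (expR (- s) * x))%R.
  by apply: measurable_funM => //; exact: (measurableT_comp mf (mc _)).
have ml : measurable_fun [set: R] l.
  by apply: measurable_funM => //; exact: measurable_fun_inv_pos.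
have law (B : set (dataType I R)) : measurable B -> P [set w | B (Z' ^~ w)] =
    \int[P]_w ((\1_B (Z ^~ w))%:E * \prod_i (l (Z i w))%:E).
  apply: (@change_of_product_law R _ _ T R P I Z Z' (EFin \o l)) => //.
  - exact/measurable_EFinP.
  - by move=> i A mA; exact: prob_scale_density.
pose L w := (\prod_i l (Z i w))%R.
have mL : measurable_fun setT L.
  by apply: measurable_prod => i _; exact: measurableT_comp.
have L0 w : (0 <= L w)%R by exact: prodr_ge0.
pose B : set (dataType I R) := [set z | (expR a <= D z <= expR b)%R].
have mB : measurable B.
  rewrite -[B]setTI (_ : B = D @^-1` [set` `[expR a, expR b]%R]).
    exact: mD.
  by apply/seteqP; split => z /=; rewrite in_itv.
have mZv := measurable_fun_data mZ; have mZ'v := measurable_fun_data mZ'.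
have mE : measurable [set w | B (Z ^~ w)].
  by rewrite -[X in measurable X]setTI; exact: mZv.
have mE' : measurable [set w | B (Z' ^~ w)].
  by rewrite -[X in measurable X]setTI; exact: mZ'v.
(* Dilated data lie outside [B], as the statistic is multiplied by [e^(ms)]. *)
have disj : [set w | B (Z ^~ w)] `&` [set w | B (Z' ^~ w)] = set0.
  apply/seteqP; split => // w [/andP[aD _] /andP[_ Db]].
  move: Db; rewrite /Z' (homD _ (Z ^~ w)) -expRM_natl => Db.
  have : (expR (m%:R * s) * expR a <= expR b)%R.
    by rewrite (le_trans _ Db)// ler_wpM2l// expR_ge0.
  by rewrite -expRD ler_expR; lra.
have := @two_point_bound R _ T P [set w | B (Z ^~ w)] L 2^-1 mE mL L0.
rewrite (_ : (2^-1 ^+ 2 / 4 = 16^-1 :> R)%R); last by field.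
apply.
- by [].
- have := law setT measurableT.
  rewrite (_ : P [set w | _] = 1); last first.
    by rewrite -(probability_setT P); congr (P _); apply/seteqP; split.
  move=> ->; rewrite le_eqVlt; apply/orP; left; apply/eqP.
  by apply: eq_integral => w _; rewrite indicT mul1e -prodEFin.
- rewrite (_ : \int[P]_w _ = P [set w | B (Z' ^~ w)]); last first.
    rewrite law//; apply: eq_integral => w _.
    by rewrite prodEFin -EFinM !indicE.
  apply: (@le_trans _ _ (P ([set w | B (Z ^~ w)] `|` [set w | B (Z' ^~ w)]))).
    by rewrite measureU.
  by apply: probability_le1; exact: measurableU.
under eq_integral do rewrite sqrt_prod// -prodEFin.
have msl : measurable_fun [set: R] (fun x => (Num.sqrt (l x))%:E).
  apply/measurable_EFinP; apply: measurableT_comp => //.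
  by apply: continuous_measurable_fun; exact: sqrt_continuous.
rewrite (@integral_prod_independent R _ _ T R P I Z
  (fun _ x => (Num.sqrt (l x))%:E))//.
have Cs1 : (C * s ^+ 2 <= 2^-1)%R.
  apply: le_trans NC; rewrite ler_peMl//.
  by rewrite ler1n.
apply: (@le_trans _ _ ((1 - C * s ^+ 2) ^+ #|I|)%:E).
  rewrite lee_fin; apply: (@le_trans _ _ (1 - #|I|%:R * (C * s ^+ 2))%R).
    lra.
  by apply: bernoulli_ineq; rewrite C0 /=; lra.
apply: expr_le_prode => [|i]; first lra.
apply: (le_trans affinity).
have h0 x : 0 <= (Num.sqrt (l x))%:E by rewrite lee_fin sqrtr_ge0.
have /= -> := ge0_integral_of_density (mZ i) mf f0' (fZ i) msl h0.
rewrite le_eqVlt; apply/orP; left; apply/eqP.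
apply: eq_integral => x _; rewrite -EFinM; congr EFin.
rewrite -[X in _ = (_ * X)%R](ger0_norm (f0' x)) -sqrtr_sqr -sqrtrM//.
by congr Num.sqrt; rewrite /l; field; exact: lt0r_neq0.
Qed.

End homogeneous.

(** * The determinant of the sample covariance *)

Section covariance.
Context (R : realType).

Definition det_covariance (n p : nat) (z : 'I_n * 'I_p -> R) : R :=
  \det (sample_covariance (fun i : 'I_n => \col_(j < p) z (i, j))).

Lemma det_covariance_scale (n p : nat) (c : R) (z : 'I_n * 'I_p -> R) :
  det_covariance (fun k => c * z k) = c ^+ (2 * p) * det_covariance z.
Proof.
rewrite /det_covariance exprM -detZ; congr (\det _).
have cE i : \col_(j < p) (c * z (i, j)) = c *: \col_(j < p) z (i, j).
  by apply/matrixP => j k; rewrite !mxE.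
rewrite /sample_covariance scalerA mulrC -scalerA; congr (_ *: _).
rewrite scaler_sumr; apply: eq_bigr => i _.
have -> : sample_mean (fun i0 : 'I_n => \col_j (c * z (i0, j))) =
  c *: sample_mean (fun i0 : 'I_n => \col_j (z (i0, j))).
  rewrite /sample_mean scalerA mulrC -scalerA; congr (_ *: _).
  by rewrite scaler_sumr; apply: eq_bigr => k _.
have trZ (u : 'cV[R]_p) : (c *: u)^T = c *: u^T.
  by apply/matrixP => j k; rewrite !mxE.
rewrite cE -scalerBr -scalemxAl trZ -scalemxAr scalerA expr2.
by [].
Qed.

Lemma measurable_det_covariance (n p : nat) :
  measurable_fun setT (@det_covariance n p : dataType ('I_n * 'I_p)%type R -> R).
Proof.
have mz k : measurable_fun setT (fun z : dataType ('I_n * 'I_p)%type R => z k).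
  exact: measurable_fun_coordinate.
have mcov j k : measurable_fun setT (fun z : dataType ('I_n * 'I_p)%type R =>
    sample_covariance (fun i : 'I_n => \col_(j < p) z (i, j)) j k).
  have mdev i j' : measurable_fun setT (fun z : dataType ('I_n * 'I_p)%type R =>
      z (i, j') - n%:R^-1 * \sum_(i' < n) z (i', j')).
    by apply: measurable_funB => //; apply: measurable_funM => //;
      exact: measurable_sum.
  rewrite (_ : (fun z => _) = fun z => n%:R^-1 * \sum_(i < n)
      ((z (i, j) - n%:R^-1 * \sum_(i' < n) z (i', j)) *
       (z (i, k) - n%:R^-1 * \sum_(i' < n) z (i', k)))).
    apply: measurable_funM => //; apply: measurable_sum => i.
    exact: measurable_funM.
  apply/funext => z; rewrite /sample_covariance mxE summxE; congr (_ * _).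
  apply: eq_bigr => i _; rewrite !mxE big_ord1 !mxE !summxE.
  by under eq_bigr do rewrite mxE; under [in X in _ * X]eq_bigr do rewrite mxE.
rewrite /det_covariance /determinant.
apply: measurable_sum => t; apply: measurable_funM => //.
by apply: measurable_prod => i _.
Qed.

(** Independence between the vectors and within each of them combine into
independence of the whole matrix of coordinates. *)
Lemma full_product_rule_coordinates (d : measure_display)
    (T : measurableType d) (P : probability T R) (n p : nat)
    (Y : 'I_n -> {RV P >-> p.-tuple R}) (f : R -> R) :
  iid_vectors_iid_coordinates Y f ->
  full_product_rule P (fun (k : 'I_n * 'I_p) w => tnth (Y k.1 w) k.2).
Proof.
move=> [indY _ indC _] A mA.
pose B i : set (p.-tuple R) := [set t | forall j, A (i, j) (tnth t j)].
have mB i : measurable (B i).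
  apply: (measurable_rectangle_preimage (Z := fun j (t : p.-tuple R) => tnth t j)
    (A := fun j => A (i, j))) => // j.
  exact: measurable_tnth.
have := indY [set: 'I_n]%SET B mB.
have -> : \bigcap_(i in [set` [set: 'I_n]%SET]) (Y i : T -> _) @^-1` B i =
    [set w | forall k : 'I_n * 'I_p, A k (tnth (Y k.1 w) k.2)].
  apply/seteqP; split => w /= H.
    by move=> [i j]; apply: (H i); rewrite /= inE.
  by move=> i _ j; exact: (H (i, j)).
move=> ->; rewrite (eq_bigl xpredT); last by move=> i; rewrite inE.
transitivity (\prod_i \prod_j
    P ((fun w => tnth (Y i w) j) @^-1` A (i, j)))%E; last first.
  by rewrite pair_bigA; apply: eq_bigr => -[].
apply: eq_bigr => i _.
have := indC i [set: 'I_p]%SET (fun j => A (i, j)) (fun j => mA _).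
have -> : \bigcap_(j in [set` [set: 'I_p]%SET])
    (fun w => tnth (Y i w) j) @^-1` A (i, j) = Y i @^-1` B i.
  apply/seteqP; split => w /= H.
    by move=> j; apply: (H j); rewrite /= inE.
  by move=> j _; exact: (H j).
move=> ->; rewrite (eq_bigl xpredT)//; by move=> j; rewrite inE.
Qed.

(** Holds for nonpositive [x] too: [lne x = -oo] avoids all bounded intervals. *)
Lemma lne_itvE (x a b : R) :
  (a%:E <= lne x%:E <= b%:E)%E = (expR a <= x <= expR b).
Proof.
have [x0|x0] := leP x 0.
  rewrite le0_lneNy ?lee_fin//=.
  by rewrite leNgt (le_lt_trans x0 (expR_gt0 a)).
have xE : expR (ln x) = x by rewrite lnK ?posrE.
by rewrite lne_EFin// !lee_fin -[in RHS]xE !ler_expR.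
Qed.

Lemma class_P1_pos_measurable (f : R -> R) : class_P1 f ->
  measurable_fun setT f /\ forall x, 0 < f x.
Proof.
move=> [V [-> _ sV _ _]]; split; last by move=> x; exact: expR_gt0.
apply: measurableT_comp => //; apply: measurableT_comp => //.
apply: continuous_measurable_fun => x.
exact/differentiable_continuous/derivable1_diffP/(sV 0%N x).
Qed.

End covariance.

(* [lne] is the extended-real logarithm, with [lne 0 = -oo]. *)
Theorem corollary2p11 (R : realType) (f : R -> R) (hf : class_P1 f)
    (p : nat -> nat) (hp : forall n : nat, (1 <= n)%N -> (0 < p n <= n)%N)
    (d : nat -> measure_display) (T : forall n : nat, measurableType (d n))
    (P : forall n : nat, probability (T n) R)
    (Y : forall n : nat, 'I_n -> {RV (P n) >-> (p n).-tuple R})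
    (hY : forall n : nat, (1 <= n)%N -> iid_vectors_iid_coordinates (Y n) f) :
  fluctuations_of_order_at_least P
    (fun (n : nat) (w : T n) =>
       lne (\det (sample_covariance
                    (fun i : 'I_n => col_of_tuple (Y n i w))))%:E)
    (fun n : nat => Num.sqrt ((p n)%:R / n%:R)).
Proof.
have [mf f0] := class_P1_pos_measurable hf.
have [C C0 affinity] := hellinger_affinity_scale hf.
(* [C c^2 <= 1/2] is what makes the affinity of the [np] coordinates >= 1/2,
   and [c <= 1] keeps the dilation parameter [s] in [[0, 1]]. *)
have [c [c0 c1 cC]] : exists c : R, [/\ 0 < c, c <= 1 & C * c ^+ 2 <= 2^-1].
  have C10 : 0 < 2 * (1 + C) by rewrite mulr_gt0// ltr_pwDl.
  exists (2 * (1 + C))^-1; split.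
  - by rewrite invr_gt0.
  - by rewrite invf_le1//; lra.
  rewrite exprVn ler_pdivrMr ?exprn_gt0// expr2.
  have : 0 <= C * C by rewrite mulr_ge0.
  lra.
exists c, (16^-1); split => //.
exists 1%N => // n /= n1 a b ab bac.
have /andP[p0 pn] := hp n n1.
have nR : (0 : R) < n%:R by rewrite ltr0n.
have pR : (0 : R) < (p n)%:R by rewrite ltr0n.
have N1 : (1 : R) <= n%:R * (p n)%:R by rewrite -natrM ler1n muln_gt0 n1.
pose r : R := Num.sqrt (n%:R * (p n)%:R).
have r2 : r ^+ 2 = n%:R * (p n)%:R by rewrite sqr_sqrtr// (le_trans ler01).
have r1 : 1 <= r by rewrite -sqrtr1 ler_sqrt// (lt_le_trans ltr01).
have r0 : 0 < r by exact: lt_le_trans ltr01 r1.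
pose s : R := c / r.
have s0 : 0 < s by rewrite divr_gt0.
have s1 : s <= 1 by rewrite ler_pdivrMr// mul1r (le_trans c1).
have prE : (p n)%:R / r = Num.sqrt ((p n)%:R / n%:R).
  rewrite -[LHS]ger0_norm; last by rewrite divr_ge0// ltW.
  rewrite -sqrtr_sqr; congr Num.sqrt; rewrite exprMn exprVn r2.
  by field; rewrite !gt_eqF.
have indep := full_product_rule_coordinates (hY n n1).
have mZ (k : 'I_n * 'I_(p n)) : measurable_fun setT (fun w => tnth (Y n k.1 w) k.2).
  exact: (measurableT_comp (measurable_tnth k.2)).
have [_ _ _ dens] := hY n n1.
have := @prob_homogeneous_statistic_le R f C _ (T n) (P n)
  ('I_n * 'I_(p n))%type (fun k w => tnth (Y n k.1 w) k.2)
  (@det_covariance R n (p n)) (2 * p n) s a b mf f0.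
have -> : [set w | (a%:E <= lne (\det (sample_covariance
      (fun i : 'I_n => col_of_tuple (Y n i w))))%:E <= b%:E)%E] =
   [set w | expR a <= det_covariance (fun k : 'I_n * 'I_(p n) => tnth (Y n k.1 w) k.2)
            <= expR b].
  by apply/funext => w /=; rewrite lne_itvE.
apply => //.
- by apply: affinity; rewrite s1 ltW.
- by rewrite mulr_ge0// sqr_ge0.
- by rewrite card_prod !card_ord muln_gt0 n1.
- rewrite card_prod !card_ord natrM -r2 /s exprMn exprVn.
  rewrite (_ : r ^+ 2 * _ = C * c ^+ 2)//.
  by field; rewrite gt_eqF.
- exact: measurable_det_covariance.
- exact: det_covariance_scale.
- rewrite (le_lt_trans bac)// -prE natrM /s.
  rewrite (_ : 2 * _ * _ = c * ((p n)%:R / r) + c * ((p n)%:R / r)); last first.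
    by field; rewrite gt_eqF.
  by rewrite ltrDl mulr_gt0// divr_gt0.
Qed.
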